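(* Let $M$ be an angle transition matrix (ATM). Then there exists $g\in G$ such that the matrix $gM$ is of one of the following three forms: (Type I) $$gM=\begin{bmatrix} c_0 & c_1 & c_1\\ c_1 & c_0 & c_1\\ c_1 & c_1 & c_0\end{bmatrix}$$ with $c_0,c_1\in\mathbb{Z}$ and $c_0+c_1+c_1=1$; (Type II) $$gM=T_w^{-1}\begin{bmatrix} c_0/3 & c_1/3 & c_1/3\\ c_1/3 & c_0/3 & c_1/3\\ c_1/3 & c_1/3 & c_0/3\end{bmatrix}$$ with $c_0,c_1\in\mathbb{Z}$, $c_0+c_1+c_1=3$, $c_0\equiv 1 \pmod 3$, where $T_w$ is the $3\times 3$ matrix that acts on $A$ as translation by $w=(1/3,1/3,-2/3)$; (Type III) $$gM=\begin{bmatrix} 0 & k & -k\\ -k & 0 & k\\ k+1 & -k+1 & 1\end{bmatrix}$$ with $k\in\mathbb{Z}$.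
   Context: Let $A=\{(x,y,z)\in\mathbb{R}^3 : x+y+z=1\}$. Let $G$ be the group of $3\times 3$ matrices generated by the permutation matrices $P_{13}$ (swapping coordinates 1 and 3) and $P_{23}$ (swapping coordinates 2 and 3) and the matrix $\begin{bmatrix}1&0&1\\0&1&1\\0&0&-1\end{bmatrix}$. Every element of $G$ leaves $A$ invariant and acts on $A$ by isometries; the action of $G$ on $A$ is that of the wallpaper group $p6m$, generated by the reflections of $A$ across the lines cut out on $A$ by the planes $x=n$, $y=n$, $z=n$, $x-y=n$, $y-z=n$, $x-z=n$ ($n\in\mathbb{Z}$). For $v,v'\in A$ write $v\sim v'$ (''$v$ is a re-expression of $v'$'') if $v'=gv$ for some $g\in G$. An angle transition matrix (ATM) is (the matrix of) an invertible linear map $M:\mathbb{R}^3\to\mathbb{R}^3$ that leaves $A$ invariant ($MA\subset A$) and preserves re-expression: for all $v,v'\in A$, $v\sim v'$ implies $Mv\sim Mv'$. The matrix $T_w$ is the linear map $v=(x,y,z)\mapsto v+(x+y+z)w$. *)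

(* Defs.v *)
From HB Require Import structures.
From mathcomp Require Import all_boot all_order all_fingroup all_algebra.
From mathcomp Require Import reals.

Set Implicit Arguments.
Unset Strict Implicit.
Unset Printing Implicit Defensive.

Import Order.TTheory GRing.Theory Num.Theory.
Local Open Scope ring_scope.

Definition rows_mx (R : realType) (m n : nat) (s : seq (seq R)) : 'M[R]_(m, n) :=
  \matrix_(i < m, j < n) nth 0 (nth [::] s i) j.

Inductive generated_mx (R : realType) (n : nat) (S : 'M[R]_n -> Prop) :
    'M[R]_n -> Prop :=
  | generated_mx_gen (g : 'M[R]_n) : S g -> generated_mx S g
  | generated_mx_one : generated_mx S 1%:M
  | generated_mx_mul (g h : 'M[R]_n) :
      generated_mx S g -> generated_mx S h -> generated_mx S (g *m h)
  | generated_mx_inv (g : 'M[R]_n) : generated_mx S g -> generated_mx S (invmx g).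

(* Coordinates are numbered from 0, so the coordinates 1, 2, 3 of the usual
   notation are the elements 0, 1, 2 of 'I_3. *)
Definition P13 (R : realType) : 'M[R]_3 := tperm_mx 0 2.
Definition P23 (R : realType) : 'M[R]_3 := tperm_mx 1 2.

(* On the plane x + y + z = 1 this is the reflection across the line z = 0. *)
Definition reflz (R : realType) : 'M[R]_3 :=
  rows_mx 3 3 [:: [:: 1; 0;  1];
                  [:: 0; 1;  1];
                  [:: 0; 0; -1]].

Definition inG (R : realType) : 'M[R]_3 -> Prop :=
  generated_mx (fun g => [\/ g = P13 R, g = P23 R | g = reflz R]).

Definition planeA (R : realType) (v : 'cV[R]_3) : Prop :=
  v 0 0 + v 1 0 + v 2 0 = 1.

Definition reexpression (R : realType) (v v' : 'cV[R]_3) : Prop :=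
  exists2 g : 'M[R]_3, inG g & v = g *m v'.

(* Linear maps are given by their matrices, acting on column vectors on the
   left. *)
Definition ATM (R : realType) (M : 'M[R]_3) : Prop :=
  [/\ M \in unitmx,
      forall v : 'cV[R]_3, planeA v -> planeA (M *m v)
    & forall v v' : 'cV[R]_3, planeA v -> planeA v' ->
        reexpression v v' -> reexpression (M *m v) (M *m v')].

Definition Tmx (R : realType) (w : 'cV[R]_3) : 'M[R]_3 :=
  1%:M + w *m const_mx 1.

Lemma TmxE (R : realType) (w v : 'cV[R]_3) :
  Tmx w *m v = v + (v 0 0 + v 1 0 + v 2 0) *: w.
Proof.
rewrite mulmxDl mul1mx -mulmxA; congr (_ + _).
apply/matrixP => i j; rewrite !mxE big_ord1 !mxE !big_ord_recr big_ord0 /=.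
rewrite !mxE !mul1r add0r mulrC (ord1 j).
by congr ((v _ _ + v _ _ + v _ _) * _); apply/val_inj.
Qed.

(* Main.v *)
(* The group G consists of the matrices e P + r 1^T with e = 1 or -1, P a
   permutation matrix, r an integer vector, and all column sums equal to 1.
   If M is an ATM and g is in G, then M g M^-1 maps every point u of A into its
   G-orbit.  Taking u among the standard basis vectors shows that M g M^-1 is an
   integer matrix, and taking u = (1 - sqrt 2 - sqrt 3, sqrt 2, sqrt 3), whose
   coordinates are linearly independent over the rationals, then shows that
   M g M^-1 itself lies in G.

   Apply this to several g.  Translations and half-turns show that differences of
   columns of M and the matrix 2M are integral.  A 3-cycle shows that M is
   integral and that the columns of M form an equilateral triangle, so that its
   two edge vectors are cyclic shifts of each other.  The swap of the first two
   coordinates shows that the triangle is symmetric about a mirror line, so an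
   edge vector is, up to scaling and permutation, (1, -1, 0), giving types I and
   II, or (1, 1, -2), giving type III. *)

Require Import Defs.
From HB Require Import structures.
From mathcomp Require Import all_boot all_order all_fingroup all_algebra.
From mathcomp Require Import reals.
From mathcomp Require Import zify ring lra.

Set Implicit Arguments.
Unset Strict Implicit.
Unset Printing Implicit Defensive.

Import Order.TTheory GRing.Theory Num.Theory.
Local Open Scope ring_scope.

(** * Indices and permutations of three coordinates *)

Lemma ord3_ind (P : 'I_3 -> Prop) : P 0 -> P 1 -> P 2 -> forall i, P i.
Proof.
move=> P0 P1 P2 [[|[|[|//]]] lti];
  [move: P0 | move: P1 | move: P2]; by congr P; apply/val_inj.
Qed.

Lemma big_ord3 (V : nmodType) (F : 'I_3 -> V) : \sum_i F i = F 0 + F 1 + F 2.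
Proof.
by rewrite !big_ord_recr big_ord0 /= add0r; congr (F _ + F _ + F _); apply/val_inj.
Qed.

Lemma perm3_exists (i j k : 'I_3) :
  uniq [:: i; j; k] -> exists s : 'S_3, [/\ s 0 = i, s 1 = j & s 2 = k].
Proof.
move=> uijk; have f_inj : injective (fun x : 'I_3 => nth i [:: i; j; k] x).
  by move=> x y /eqP; rewrite nth_uniq //= => /eqP /val_inj.
by exists (perm f_inj); rewrite !permE.
Qed.

(** * The group [inG] as signed permutations with an integral translation part *)

Section AffineForm.
Variable R : realType.
Implicit Types (M g h : 'M[R]_3) (r u v : 'cV[R]_3) (s : 'S_3).

Local Notation ones := (const_mx 1 : 'rV[R]_3).

(** On vectors of coordinate sum 1 the rank-one term adds [r], so the matrix acts there as a signed
    permutation followed by translation by [r]; [e = true] is the sign -1. *)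
Definition affine_mx (e : bool) s r : 'M[R]_3 := (-1) ^+ e *: perm_mx s + r *m ones.

Definition in_affine g :=
  exists e s r, [/\ g = affine_mx e s r, r \is a mxOver Num.int & ones *m g = ones].

Lemma ones_perm s : ones *m perm_mx s = ones.
Proof.
by rewrite -[s]invgK -col_permE; apply/matrixP => i j; rewrite !mxE.
Qed.

Lemma planeA_ones v : planeA v <-> ones *m v = 1%:M.
Proof.
rewrite /planeA; split=> [v1|/matrixP/(_ 0 0)].
  by apply/matrixP => i j; rewrite !ord1 !mxE big_ord3 !mxE !mul1r.
by rewrite !mxE big_ord3 !mxE !mul1r.
Qed.

Lemma planeA_delta (j : 'I_3) : planeA (delta_mx j 0 : 'cV[R]_3).
Proof. by rewrite /planeA !mxE; move: j; apply: ord3_ind => /=; ring. Qed.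

Lemma affine_mxE e s r M (i j : 'I_3) : ones *m M = ones ->
  (affine_mx e s r *m M) i j = (-1) ^+ e * M (s i) j + r i 0.
Proof.
move=> M1; rewrite mulmxDl -mulmxA M1 -scalemxAl -row_permE !mxE big_ord1 !mxE.
by rewrite mulr1.
Qed.

Lemma affine_mx_int e s r : r \is a mxOver Num.int -> affine_mx e s r \is a mxOver Num.int.
Proof.
move=> /mxOverP rZ; apply/mxOverP => i j; rewrite !mxE big_ord1 !mxE mulr1.
by rewrite rpredD ?rpredM ?rpredX ?rpredN1 ?rpred_nat.
Qed.

Lemma in_affine_int g : in_affine g -> g \is a mxOver Num.int.
Proof. by case=> e [s] [r] [-> rZ _]; apply: affine_mx_int. Qed.

Lemma in_affine_ones g : in_affine g -> ones *m g = ones.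
Proof. by case=> e [s] [r] []. Qed.

Lemma signed_perm_mxM (e f : bool) s t :
  ((-1) ^+ e *: perm_mx s) *m ((-1) ^+ f *: perm_mx t) =
  (-1) ^+ (e (+) f) *: perm_mx (s * t)%g :> 'M[R]_3.
Proof. by rewrite -scalemxAl -scalemxAr scalerA perm_mxM signr_addb. Qed.

Lemma in_affineM g h : in_affine g -> in_affine h -> in_affine (g *m h).
Proof.
case=> e [s] [r] [-> rZ g1] [f] [t] [q] [-> qZ h1].
exists (e (+) f), (s * t)%g, ((-1) ^+ e *: perm_mx s *m q + r); split.
- rewrite {1}/affine_mx mulmxDl -[r *m _ *m _]mulmxA h1 /affine_mx mulmxDr.
  by rewrite signed_perm_mxM mulmxDl mulmxA addrA.
- apply/mxOverP => i j; rewrite -scalemxAl -row_permE !mxE rpredD ?(mxOverP rZ) //.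
  by rewrite rpredM ?rpredX ?rpredN1 ?(mxOverP qZ).
- by rewrite mulmxA g1 h1.
Qed.

Lemma in_affineV g : in_affine g -> in_affine (invmx g).
Proof.
case=> e [s] [r] [gE rZ g1].
(* [H] inverts the signed permutation part, and [ones *m g = ones] lets the rank-one correction
   cancel the translation part. *)
pose H : 'M[R]_3 := (-1) ^+ e *: perm_mx s^-1; pose g' := H - H *m r *m ones.
have g'g : g' *m g = 1%:M.
  rewrite mulmxBl -[_ *m g in X in _ - X]mulmxA g1 -mulmxA -mulmxBr gE addrK.
  by rewrite signed_perm_mxM mulVg perm_mx1 addbb scale1r.
have [gU _] := mulmx1_unit (mulmx1C g'g).
have -> : invmx g = g' by rewrite -[g']mulmx1 -(mulmxV gU) mulmxA g'g mul1mx.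
exists e, s^-1%g, (- (H *m r)); split.
- by rewrite /affine_mx mulNmx.
- apply/mxOverP => i j; rewrite -scalemxAl -row_permE !mxE rpredN.
  by rewrite rpredM ?rpredX ?rpredN1 ?(mxOverP rZ).
- by rewrite -{1}g1 -mulmxA (mulmx1C g'g) mulmx1.
Qed.

Lemma inG_affine g : inG g -> in_affine g.
Proof.
elim=> {g} [g|| |].
- have perm_affine s : in_affine (perm_mx s).
    exists false, s, 0; split; last exact: ones_perm.
    + by rewrite /affine_mx mul0mx addr0 scale1r.
    + by apply/mxOverP => i j; rewrite mxE rpred0.
  case=> ->; [exact: perm_affine|exact: perm_affine|].
  (* [reflz] is minus the swap of the first two coordinates, plus (1, 1, 0) in every column. *)
  exists true, (tperm 0 1), (\col_i (i != 2)%:R); split.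
  + apply/matrixP => i j; rewrite !mxE big_ord1 !mxE.
    by move: i j; do 2![apply: ord3_ind]; rewrite permE /= ?mxE /=; ring.
  + by apply/mxOverP => i j; rewrite mxE rpred_nat.
  + apply/matrixP => i j; rewrite !mxE big_ord3 !mxE !mul1r.
    by move: j; apply: ord3_ind => /=; ring.
- exists false, 1%g, 0; split.
  + by rewrite /affine_mx mul0mx addr0 scale1r perm_mx1.
  + by apply/mxOverP => i j; rewrite mxE rpred0.
  + by rewrite mulmx1.
- by move=> g h _ Gg _ Gh; apply: in_affineM.
- by move=> g _ Gg; apply: in_affineV.
Qed.

Lemma inG_perm s : inG (perm_mx s : 'M[R]_3).
Proof.
have P12 : tperm_mx 0 1 = P13 R *m P23 R *m P13 R.
  rewrite -!perm_mxM; congr perm_mx; apply/permP; apply: ord3_ind;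
    rewrite !permM !permE /= ?permE /=; exact/val_inj.
have tpermG (i j : 'I_3) : @inG R (tperm_mx i j).
  have G02 : @inG R (tperm_mx 0 2) by apply: generated_mx_gen; constructor 1.
  have G12 : @inG R (tperm_mx 1 2) by apply: generated_mx_gen; constructor 2.
  have G01 : @inG R (tperm_mx 0 1).
    by rewrite P12; apply: generated_mx_mul => //; apply: generated_mx_mul.
  have G1 : inG (1%:M : 'M[R]_3) by apply: generated_mx_one.
  by move: i j; do 2![apply: ord3_ind => //];
    rewrite /tperm_mx ?tperm1 ?perm_mx1 // tpermC.
have [ts -> _] := prod_tpermP s.
elim: ts => [|t ts IHts]; first by rewrite big_nil perm_mx1; apply: generated_mx_one.
by rewrite big_cons perm_mxM; exact: generated_mx_mul (tpermG _ _) IHts.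
Qed.

(** On A this is the half-turn about the midpoint of the two basis vectors other than e_i. For i = 2
    it is the product of the reflections in the perpendicular lines z = 0 and x = y; conjugating by
    a transposition gives the other cases. *)
Lemma inG_half_turn (i : 'I_3) :
  inG (- 1%:M + (\col_j (j != i)%:R) *m ones : 'M[R]_3).
Proof.
have half_turn2 : - 1%:M + (\col_j (j != 2)%:R) *m ones = reflz R *m perm_mx (tperm 0 1).
  apply/matrixP => j k; rewrite -[tperm 0 1]invgK -col_permE !mxE big_ord1 !mxE.
  by move: j k; do 2![apply: ord3_ind]; rewrite tpermV permE /=; ring.
have -> : - 1%:M + (\col_j (j != i)%:R) *m ones =
    perm_mx (tperm i 2) *m (reflz R *m perm_mx (tperm 0 1)) *m perm_mx (tperm i 2).
  rewrite -half_turn2 mulmxDr mulmxDl mulmxN mulmx1 mulNmx -perm_mxM tperm2 perm_mx1.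
  rewrite mulmxA -mulmxA ones_perm; congr (_ + _ *m _).
  apply/matrixP => j k; rewrite -row_permE !mxE; congr (~~ _)%:R.
  by rewrite -(inj_eq (@perm_inj _ (tperm i 2))) tpermL.
apply: generated_mx_mul; last exact: inG_perm.
apply: generated_mx_mul; first exact: inG_perm.
by apply: generated_mx_mul; [apply: generated_mx_gen; constructor 3 | exact: inG_perm].
Qed.

Lemma translation_mxM r u : ones *m u = 0 ->
  (1%:M + r *m ones) *m (1%:M + u *m ones) = 1%:M + (r + u) *m ones.
Proof.
move=> u0; rewrite mulmxDr mulmx1 mulmxA mulmxDl mul1mx -[r *m _ *m _]mulmxA u0.
by rewrite mulmx0 addr0 -addrA -mulmxDl.
Qed.

Lemma inG_translationMz r (z : int) : ones *m r = 0 ->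
  inG (1%:M + r *m ones) -> inG (1%:M + (r *~ z) *m ones).
Proof.
move=> r0 Gr.
have GrM (n : nat) : inG (1%:M + (r *+ n) *m ones).
  elim: n => [|n IHn]; first by rewrite mul0mx addr0; apply: generated_mx_one.
  by rewrite mulrSr -translation_mxM //; apply: generated_mx_mul.
case: z => n; first exact: GrM.
have rn0 : ones *m (r *+ n.+1) = 0 by rewrite raddfMn /= r0 mul0rn.
have TV : (1%:M + (r *~ Negz n) *m ones) *m (1%:M + (r *+ n.+1) *m ones) = 1%:M.
  by rewrite translation_mxM // NegzE mulrNz pmulrn addNr mul0mx addr0.
have [_ TU] := mulmx1_unit TV.
have -> : 1%:M + (r *~ Negz n) *m ones = invmx (1%:M + (r *+ n.+1) *m ones).
  by apply: (can_inj (mulmxK TU)); rewrite TV mulVmx.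
exact: generated_mx_inv (GrM _).
Qed.

(** Two half-turns compose to a translation. This yields the vectors [d i] = e_2 - e_i, and [d 0],
    [d 1] span the integral vectors of coordinate sum 0. *)
Lemma inG_translation r : r \is a mxOver Num.int -> ones *m r = 0 ->
  inG (1%:M + r *m ones).
Proof.
move=> /mxOverP rZ r0.
pose d (i : 'I_3) : 'cV[R]_3 := \col_j ((j == 2)%:R - (j == i)%:R).
have d0 i : ones *m d i = 0.
  apply/matrixP => j k; rewrite !mxE big_ord3 !mxE !mul1r.
  by move: i; apply: ord3_ind => /=; ring.
have Gd i : inG (1%:M + d i *m ones).
  have -> : 1%:M + d i *m ones = (- 1%:M + (\col_j (j != i)%:R) *m ones) *m
                                 (- 1%:M + (\col_j (j != 2)%:R) *m ones).
    apply/matrixP => j k; rewrite !mxE !big_ord1 !big_ord3 !mxE !big_ord1 !mxE.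
    by move: i j k; do 3![apply: ord3_ind] => /=; ring.
  by apply: generated_mx_mul; apply: inG_half_turn.
have /intrP[x xE] := rZ 0 0; have /intrP[y yE] := rZ 1 0.
have rE : r = d 0 *~ (- x) + d 1 *~ (- y).
  have r2 : r 2 0 = - r 0 0 - r 1 0.
    by move/matrixP/(_ 0 0): r0; rewrite !mxE big_ord3 !mxE !mul1r => r0; lra.
  apply/matrixP => i j; rewrite (ord1 j) -!scaler_int !mxE.
  by move: i; apply: ord3_ind; rewrite ?r2 ?xE ?yE /= !mulrNz; ring.
rewrite rE -translation_mxM; last by rewrite -scaler_int -scalemxAr d0 scaler0.
by apply: generated_mx_mul; apply: inG_translationMz.
Qed.

(** Column sums 1 force the coordinate sum of [r] to be 0 for sign + and 2 for sign -. The first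
    case is a translation times a permutation; in the second, splitting off the half-turn with
    translation part (1, 1, 0) leaves a vector of sum 0. *)
Lemma affine_inG g : in_affine g -> inG g.
Proof.
case=> e [s] [r] [-> rZ h1].
have sumr : ones *m r = (1 - (-1) ^+ e)%:M.
  have := congr1 (fun x : 'rV_3 => x 0 0) h1.
  rewrite mulmxDr -scalemxAr ones_perm mulmxA !mxE big_ord1 !mxE big_ord3 !mxE !mulr1 !mul1r => h.
  by apply/matrixP => i j; rewrite !ord1 !mxE eqxx mulr1n big_ord3 !mxE; lra.
case: e sumr {h1} => /= sumr; last first.
  rewrite /affine_mx scale1r -(mul1mx (perm_mx s)) -(ones_perm s) mulmxA -mulmxDl.
  apply: generated_mx_mul; last exact: inG_perm.
  by apply: inG_translation => //; rewrite sumr subrr raddf0.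
pose q : 'cV[R]_3 := \col_j (j != 2)%:R.
have sumq : ones *m q = 2%:M.
  apply/matrixP => i j; rewrite !ord1 !mxE big_ord3 !mxE /=; ring.
have -> : affine_mx true s r =
    (1%:M + (r - q) *m ones) *m (- 1%:M + q *m ones) *m perm_mx s.
  have half_turn1 : ones *m (- 1%:M + q *m ones) = ones.
    rewrite mulmxDr mulmxN mulmx1 mulmxA sumq mul_scalar_mx scaler_nat mulr2n.
    by rewrite addKr.
  rewrite mulmxDl mul1mx -mulmxA half_turn1 -addrA -mulmxDl [q + _]addrC subrK.
  by rewrite mulmxDl mulNmx mul1mx -mulmxA ones_perm -scaleN1r.
apply: generated_mx_mul; last exact: inG_perm.
apply: generated_mx_mul; last exact: inG_half_turn.
apply: inG_translation.
  by apply/mxOverP => i j; rewrite !mxE rpredB ?rpred_nat ?(mxOverP rZ).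
by rewrite mulmxBr sumr sumq -raddfB /= opprK subrr raddf0.
Qed.

End AffineForm.

(** * Independence of 1, sqrt 2 and sqrt 3 over the rationals *)

(** For nonzero [n] the p-adic valuations of the two sides would have opposite parities. *)
Lemma sqr_eq_natM_sqr (p k : nat) (m n : int) :
  (0 < k)%N -> odd (logn p k) -> m ^+ 2 = k%:Z * n ^+ 2 -> n = 0.
Proof.
move=> k_gt0 odd_k mkn; apply/eqP; apply: contraLR odd_k => n_neq0.
have mknN : (`|m| ^ 2 = k * `|n| ^ 2)%N by rewrite -!abszX mkn abszM.
have n_gt0 : (0 < `|n|)%N by rewrite absz_gt0.
have := congr1 (odd \o logn p) mknN.
by rewrite /= lognM ?expn_gt0 ?n_gt0 // !lognX oddD !oddM addbF => <-.
Qed.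

(** Isolating r sqrt 3 and squaring leaves 2pq as coefficient of sqrt 2, so pq = 0. Then p^2 + 2q^2
    = 3r^2 forces r = 0, by 2-adic valuation if p = 0 and 3-adic valuation if q = 0. *)
Lemma sqrt2_sqrt3_free (R : rcfType) (p q r : int) :
  p%:~R + q%:~R * Num.sqrt 2 + r%:~R * Num.sqrt 3 = 0 :> R -> [/\ p = 0, q = 0 & r = 0].
Proof.
set s2 := Num.sqrt 2; set s3 := Num.sqrt 3 => h.
have s2E : s2 ^+ 2 = 2 by rewrite sqr_sqrtr.
have s3E : s3 ^+ 2 = 3 by rewrite sqr_sqrtr.
have h2 : (p%:~R) ^+ 2 + 2 * (q%:~R) ^+ 2 + 2 * p%:~R * q%:~R * s2 = 3 * (r%:~R) ^+ 2 :> R.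
  rewrite -s3E [RHS]mulrC -exprMn (_ : r%:~R * s3 = - (p%:~R + q%:~R * s2)); last by lra.
  by rewrite sqrrN sqrrD exprMn s2E; ring.
have pq0 : 2 * p * q = 0.
  apply: (@sqr_eq_natM_sqr 2 2 (3 * r ^+ 2 - p ^+ 2 - 2 * q ^+ 2)) => //.
  apply: (@intr_inj R); rewrite !(rmorphM, rmorphXn, rmorphB) /=.
  transitivity ((2 * p%:~R * q%:~R * s2) ^+ 2); first by congr (_ ^+ 2); lra.
  by rewrite exprMn s2E; ring.
have hr : p ^+ 2 + 2 * q ^+ 2 = 3 * r ^+ 2.
  apply: (@intr_inj R); rewrite !(rmorphM, rmorphXn, rmorphD) /= -h2.
  have -> : 2 * p%:~R * q%:~R = (2 * p * q)%:~R :> R by rewrite !rmorphM.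
  by rewrite pq0 mul0r addr0.
have r0 : r = 0.
  have /orP[/eqP p0|/eqP q0] : (p == 0) || (q == 0) by lia.
    by apply: (@sqr_eq_natM_sqr 2 6 (2 * q)) => //; rewrite p0 in hr; lia.
  by apply: (@sqr_eq_natM_sqr 3 3 p) => //; rewrite q0 in hr; lia.
by rewrite r0 in hr *; split; nia.
Qed.

(** * Integer triangles of columns and their symmetries *)

Lemma perm3_cases (s : 'S_3) : exists i j k,
  [/\ s 0 = i, s 1 = j, s 2 = k & uniq [:: i; j; k]].
Proof.
by exists (s 0), (s 1), (s 2); split=> //; rewrite /= !inE !(inj_eq perm_inj).
Qed.

(* Here w is twice the matrix, since 2M is known to be integral before M is. *)
Lemma cyclic_symmetry (w d : 'I_3 -> 'I_3 -> int) (e : bool) (s : 'S_3) (r : 'I_3 -> int) :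
  (forall j, w 0 j + w 1 j + w 2 j = 2) ->
  (forall i j, w i j = w i 0 + 2 * d i j) ->
  (forall i, [/\ w i 1 = (-1) ^+ e * w (s i) 0 + 2 * r i,
                 w i 2 = (-1) ^+ e * w (s i) 1 + 2 * r i
               & w i 0 = (-1) ^+ e * w (s i) 2 + 2 * r i]) ->
  (forall i, w i 0 = w i 1) \/
  (forall i j, exists m, w i j = 2 * m) /\
  (exists c : 'S_3,
    [/\ w (c 0) 1 - w (c 0) 2 = w (c 1) 0 - w (c 1) 1,
        w (c 1) 1 - w (c 1) 2 = w (c 2) 0 - w (c 2) 1
      & w (c 2) 1 - w (c 2) 2 = w (c 0) 0 - w (c 0) 1]).
Proof.
move=> w1 wd wC.
(* If [s] is not a 3-cycle or the sign is -1, iterating the relations makes the columns equal.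
   Otherwise all entries have one parity, which is even because the column sums are 2; [p] and [q]
   follow the two possible 3-cycles. *)
have [p [p0 p1 p2]] := @perm3_exists 0 1 2 isT.
have [q [q0 q1 q2]] := @perm3_exists 0 2 1 isT.
have [i [j [k [s0 s1 s2 ijk]]]] := perm3_cases s.
have [] := wC 0; have [] := wC 1; have [] := wC 2; rewrite s0 s1 s2.
have := w1 0; have := w1 1; have := w1 2; have := wd 0 1; have := wd 1 1; have := wd 2 1.
have := wd 0 2; have := wd 1 2; have := wd 2 2.
move: i j k ijk {s0 s1 s2 w1 wd wC}; do 3![apply: ord3_ind => //] => _;
  case: e; rewrite ?expr1 ?expr0 ?mulN1r ?mul1r => *;
  solve [ left; apply: ord3_ind; lia
        | right; split; [ by move=> i j; exists (w i j %/ 2)%Z; move: i j; do 2![apply: ord3_ind]; lia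
                        | exists p; rewrite p0 p1 p2; split; lia ]
        | right; split; [ by move=> i j; exists (w i j %/ 2)%Z; move: i j; do 2![apply: ord3_ind]; lia
                        | exists q; rewrite q0 q1 q2; split; lia ] ].
Qed.

Definition typeI_form (m : 'I_3 -> 'I_3 -> int) := exists (k : int) (t : 'I_3 -> int),
  forall i j, m i j = (if i == j then k else 0) + t i.

(** The column differences are k times the cyclic shifts of (-1, -1, 2), against the pattern (1, -1,
    0) of [typeI_form]; in both, [t] is what a translation can remove. *)
Definition typeIII_form (m : 'I_3 -> 'I_3 -> int) := exists (k : int) (t : 'I_3 -> int),
  forall i j, m i j =
    k * nth 0 (nth [::] [:: [:: 0; 1; -1]; [:: -1; 0; 1]; [:: 1; -1; 0]] i) j + t i.

(** Column 0 minus column 1 has coordinate sum 0: a vanishing last entry makes it (k, -k, 0), equal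
    first entries make it (-k, -k, 2k). The shift relations then determine column 2. *)
Lemma equilateral_form (m : 'I_3 -> 'I_3 -> int) :
  (forall j, m 0 j + m 1 j + m 2 j = 1) ->
  [/\ m 0 1 - m 0 2 = m 2 0 - m 2 1, m 1 1 - m 1 2 = m 0 0 - m 0 1
     & m 2 1 - m 2 2 = m 1 0 - m 1 1] ->
  m 2 0 = m 2 1 \/ m 0 0 - m 0 1 = m 1 0 - m 1 1 ->
  typeI_form m \/ typeIII_form m.
Proof.
move=> m1 [b0 b1 b2]; have := m1 0; have := m1 1 => {}m1 m1' [a2|a01].
- left; exists (m 0 0 - m 0 1), (fun i => nth 0 [:: m 0 1; m 1 0; m 2 0] i).
  by do 2![apply: ord3_ind] => /=; lia.
- right; exists (m 0 1 - m 0 0), (fun i => nth 0 [:: m 0 0; m 1 1; m 2 2] i).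
  by do 2![apply: ord3_ind] => /=; lia.
Qed.

Lemma reflection_symmetry (m : 'I_3 -> 'I_3 -> int) (e : bool) (s : 'S_3) (r : 'I_3 -> int) :
  (forall j, m 0 j + m 1 j + m 2 j = 1) ->
  [/\ m 0 1 - m 0 2 = m 1 0 - m 1 1, m 1 1 - m 1 2 = m 2 0 - m 2 1
     & m 2 1 - m 2 2 = m 0 0 - m 0 1] ->
  (forall i, [/\ m i 1 = (-1) ^+ e * m (s i) 0 + r i,
                 m i 0 = (-1) ^+ e * m (s i) 1 + r i
               & m i 2 = (-1) ^+ e * m (s i) 2 + r i]) ->
  exists c : 'S_3, typeI_form (fun i => m (c i)) \/ typeIII_form (fun i => m (c i)).
Proof.
move=> m1 [b0 b1 b2] mC.
(* Running through all [s] and both signs, some entry of column 0 minus column 1 vanishes or the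
   other two entries agree; the alternatives record the distinguished row. *)
have aP : [\/ m 0 0 = m 0 1 \/ m 2 0 - m 2 1 = m 1 0 - m 1 1,
              m 1 0 = m 1 1 \/ m 0 0 - m 0 1 = m 2 0 - m 2 1
            | m 2 0 = m 2 1 \/ m 1 0 - m 1 1 = m 0 0 - m 0 1].
  have [i [j [k [s0 s1 s2 ijk]]]] := perm3_cases s.
  have [] := mC 0; have [] := mC 1; have [] := mC 2; rewrite s0 s1 s2.
  have := m1 0; have := m1 1; have := m1 2.
  move: i j k ijk {s0 s1 s2 m1 mC} b0 b1 b2; do 3![apply: ord3_ind => //] => _;
    case: e; rewrite ?expr1 ?expr0 ?mulN1r ?mul1r => *;
    solve [ constructor 1; lia | constructor 2; lia | constructor 3; lia ].
(* Each permutation moves the distinguished row to the end. All three are transpositions, because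
   [equilateral_form] uses the opposite cyclic orientation. *)
have [c0 [c00 c01 c02]] := @perm3_exists 2 1 0 isT.
have [c1 [c10 c11 c12]] := @perm3_exists 0 2 1 isT.
have [c2 [c20 c21 c22]] := @perm3_exists 1 0 2 isT.
case: aP => a.
- exists c0; apply: equilateral_form; rewrite c00 c01 c02 // => j.
  by have := m1 j; lia.
- exists c1; apply: equilateral_form; rewrite c10 c11 c12 // => j.
  by have := m1 j; lia.
- exists c2; apply: equilateral_form; rewrite c20 c21 c22 // => j.
  by have := m1 j; lia.
Qed.

(** * Conjugates of group elements by an ATM *)

Section Conjugation.
Variables (R : realType) (M : 'M[R]_3).
Hypothesis ATM_M : ATM M.
Implicit Types (g h : 'M[R]_3).

Local Notation ones := (const_mx 1 : 'rV[R]_3).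

Lemma ATM_ones : ones *m M = ones.
Proof.
have [_ MA _] := ATM_M.
apply/matrixP => i j; rewrite !mxE.
have /planeA_ones/matrixP/(_ 0 0) : planeA (M *m delta_mx j 0).
  by apply: MA; apply: planeA_delta.
rewrite -colE !mxE => sumM; apply: etrans sumM.
by apply: eq_bigr => k _; rewrite !mxE.
Qed.

(** [M] preserves the re-expression between g M^-1 u and M^-1 u. The element [h] may depend on
    [u]. *)
Lemma ATM_conj_orbit g (u : 'cV[R]_3) : inG g -> planeA u ->
  exists2 h, inG h & M *m g *m invmx M *m u = h *m u.
Proof.
have [MU _ Mrel] := ATM_M; move=> Gg /planeA_ones u1.
have MV1 : ones *m invmx M = ones by rewrite -{1}ATM_ones mulmxK.
have Au : planeA (invmx M *m u) by apply/planeA_ones; rewrite mulmxA MV1.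
have Agu : planeA (g *m (invmx M *m u)).
  apply/planeA_ones; rewrite mulmxA (in_affine_ones (inG_affine Gg)).
  exact/planeA_ones.
have [h Gh hE] := Mrel _ _ Agu Au (ex_intro2 _ _ g Gg erefl).
by exists h => //; rewrite -!mulmxA hE mulKVmx.
Qed.

Lemma ATM_conj g : inG g -> exists2 h, inG h & M *m g = h *m M.
Proof.
have [MU _ _] := ATM_M; move=> Gg.
set N := M *m g *m invmx M.
have NZ : N \is a mxOver Num.int.
  apply/mxOverP => i j.
  have [h Gh] := ATM_conj_orbit Gg (planeA_delta R j).
  move/matrixP/(_ i 0); rewrite -!colE [LHS]mxE [RHS]mxE => ->.
  by have /mxOverP := in_affine_int (inG_affine Gh).
pose u : 'cV[R]_3 := \col_i [:: 1 - Num.sqrt 2 - Num.sqrt 3; Num.sqrt 2; Num.sqrt 3]`_i.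
have [|h Gh Nu] := @ATM_conj_orbit g u Gg.
  by rewrite /planeA !mxE /=; ring.
exists h => //; suff <- : N = h by rewrite /N mulmxKV.
have hZ := in_affine_int (inG_affine Gh).
have DZ i j : (N - h) i j \is a Num.int.
  by rewrite mxE [X in _ + X]mxE rpredB ?(mxOverP NZ) ?(mxOverP hZ).
suff: N - h = 0 by move/eqP; rewrite subr_eq0 => /eqP.
have Du : (N - h) *m u = 0 by rewrite mulmxBl Nu subrr.
apply/matrixP => i j; move/matrixP/(_ i 0): Du; rewrite mxE big_ord3.
have /intrP[p pE] := DZ i 0; have /intrP[q qE] := DZ i 1; have /intrP[r rE] := DZ i 2.
rewrite pE qE rE ![u _ _]mxE [RHS]mxE /= => pqr.
(* Row i of [N - h] applied to [u] is p + (q - p) sqrt 2 + (r - p) sqrt 3. *)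
have [|p0 q0 r0] := @sqrt2_sqrt3_free R p (q - p) (r - p).
  by rewrite !rmorphB /= -pqr; ring.
rewrite [RHS]mxE; move: j; apply: ord3_ind; rewrite ?pE ?qE ?rE.
- by rewrite p0.
- by rewrite (_ : q = 0) //; lia.
- by rewrite (_ : r = 0) //; lia.
Qed.

(** Since [ones *m M = ones], the conjugate of c + r 1^T by M is c + (M r) 1^T, which lies in G and
    is therefore integral. *)
Lemma ATM_integral_mulmx (c : int) (r : 'cV[R]_3) :
  inG (c%:~R%:M + r *m ones) -> M *m r \is a mxOver Num.int.
Proof.
have [MU _ _] := ATM_M.
move=> /ATM_conj[h Gh]; rewrite mulmxDr mulmxA scalar_mxC -ATM_ones mulmxA -mulmxDl.
move/(can_inj (mulmxK MU)) => hE; apply/mxOverP => i j.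
have := mxOverP (in_affine_int (inG_affine Gh)) i 0; rewrite -hE mxE.
rewrite mxE [X in _ + X]mxE big_ord1 [ones _ _]mxE mulr1 (ord1 j).
by rewrite rpredDl // -mulr_natr rpredM ?rpred_nat ?rpred_int.
Qed.

Lemma ATM_perm (t : 'S_3) : exists (e : bool) (s : 'S_3) (r : 'I_3 -> int),
  forall i j, M i (t j) = (-1) ^+ e * M (s i) j + (r i)%:~R.
Proof.
have [h /inG_affine[e [s [r [-> /mxOverP rZ _]]]] /matrixP hE] := ATM_conj (inG_perm R t^-1).
exists e, s, (fun i => Num.floor (r i 0)) => i j.
rewrite floorK // -(affine_mxE e s r i j (ATM_ones)).
by rewrite -hE -col_permE mxE.
Qed.

Lemma inG_translation_delta (i j : 'I_3) :
  inG (1%:M + (delta_mx i 0 - delta_mx j 0) *m ones).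
Proof.
apply: inG_translation.
  by apply/mxOverP => k l; rewrite !mxE rpredB ?rpred_nat.
apply/matrixP => k l; rewrite !mxE big_ord3 !mxE !mul1r !ord1.
by move: i j; do 2![apply: ord3_ind] => /=; ring.
Qed.

(** On A this is the half-turn about e_i itself; it is what makes 2 M e_i integral. *)
Lemma inG_half_turn_delta (i : 'I_3) :
  inG ((-1)%:~R%:M + (delta_mx i 0 *+ 2) *m ones : 'M[R]_3).
Proof.
apply: affine_inG; exists true, 1%g, (delta_mx i 0 *+ 2); split.
- by rewrite /affine_mx perm_mx1 scaleN1r mulrN1z raddfN.
- by apply/mxOverP => k l; rewrite mulr2n !mxE rpredD ?rpred_nat.
- apply/matrixP => k l; rewrite !mxE big_ord3 !mxE !big_ord1 !mxE.
  by move: i l; do 2![apply: ord3_ind] => /=; ring.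
Qed.

Lemma ATM_doubled_int : exists w d : 'I_3 -> 'I_3 -> int,
  (forall i j, 2 * M i j = (w i j)%:~R) /\
  (forall i j, w i j = w i 0 + 2 * d i j).
Proof.
have wZ i j : 2 * M i j \is a Num.int.
  have := mxOverP (ATM_integral_mulmx (inG_half_turn_delta j)) i 0.
  by rewrite -scaler_nat -scalemxAr -colE mxE mxE.
have dZ i j : M i j - M i 0 \is a Num.int.
  have := mxOverP (@ATM_integral_mulmx 1 _ (inG_translation_delta j 0)) i 0.
  by rewrite mulmxBr -!colE mxE [X in _ + X]mxE ![col _ _ _ _]mxE.
exists (fun i j => Num.floor (2 * M i j)), (fun i j => Num.floor (M i j - M i 0)).
split=> i j; first by rewrite floorK.
apply: (@intr_inj R); rewrite rmorphD rmorphM /= !floorK //; ring.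
Qed.

Lemma ATM_integral_form : exists (c : 'S_3) (m : 'I_3 -> 'I_3 -> int),
  (forall i j, M (c i) j = (m i j)%:~R) /\ (typeI_form m \/ typeIII_form m).
Proof.
have [MU _ _] := ATM_M.
have [w [d [wE wd]]] := ATM_doubled_int.
have w_perm (t : 'S_3) : exists (e : bool) (s : 'S_3) (r : 'I_3 -> int),
    forall i j, w i (t j) = (-1) ^+ e * w (s i) j + 2 * r i.
  have [e [s [r MP]]] := ATM_perm t; exists e, s, r => i j.
  apply: (@intr_inj R); rewrite rmorphD !rmorphM rmorphXn rmorphN /= -!wE MP; ring.
have w1 j : w 0 j + w 1 j + w 2 j = 2.
  apply: (@intr_inj R); rewrite !rmorphD /= -!wE.
  move/matrixP/(_ 0 j): ATM_ones; rewrite !mxE big_ord3 !mxE !mul1r => Mj.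
  by rewrite -!mulrDr Mj mulr1.
(* Two equal columns would contradict invertibility, which excludes the degenerate outcome of
   [cyclic_symmetry]. *)
have M_neq : ~ forall i, w i 0 = w i 1.
  move=> w01; have M01 : M *m (delta_mx 0 0 - delta_mx 1 0) = 0 :> 'cV_3.
    apply/matrixP => i j; rewrite mulmxBr -!colE (ord1 j) !mxE.
    by have := wE i 0; have := wE i 1; rewrite w01 => h1 h0; lra.
  have /matrixP/(_ 0 0) : delta_mx 0 0 - delta_mx 1 0 = 0 :> 'cV[R]_3.
    by rewrite -[LHS](mulKmx MU) M01 mulmx0.
  by rewrite !mxE /= subr0 => /eqP; rewrite oner_eq0.
have [cyc [cyc0 cyc1 cyc2]] := @perm3_exists 1 2 0 isT.
have [e [s [r wC]]] := w_perm cyc.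
have [|/M_neq//|[w_even [b [b0 b1 b2]]]] := cyclic_symmetry w1 wd (e := e) (s := s) (r := r).
  by move=> i; rewrite -!wC cyc0 cyc1 cyc2.
have [x xE] : exists x : 'I_3 -> 'I_3 -> int, forall i j, w i j = 2 * x i j.
  by exists (fun i j => (w i j %/ 2)%Z) => i j; have [y] := w_even i j; lia.
have [e' [s' [r' wT]]] := w_perm (tperm 0 1).
(* The rows are relabelled by [b], so the row permutation [s'] is replaced by its conjugate. *)
pose s2 := (b * s' * b^-1)%g.
have [||i|c cE] := @reflection_symmetry (fun i => x (b i)) e' s2 (fun i => r' (b i)).
- move=> j /=; have [i0 [i1 [i2 [-> -> -> u]]]] := perm3_cases b.
  have := w1 j; rewrite !xE.
  by move: i0 i1 i2 u; do 3![apply: ord3_ind => //] => _; lia.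
- have half (p q u v : int) : 2 * p - 2 * q = 2 * u - 2 * v -> p - q = u - v by lia.
  by split; apply: half; rewrite -!xE.
- have bs2 : b (s2 i) = s' (b i) by rewrite /s2 !permM permKV.
  have half (p q u : int) : 2 * p = (-1) ^+ e' * (2 * q) + 2 * u -> p = (-1) ^+ e' * q + u.
    by case: (e'); rewrite ?expr1 ?expr0 ?mulN1r ?mul1r; lia.
  rewrite bs2; split; apply: half; rewrite -!xE -wT ?tpermL ?tpermR //.
  by rewrite tpermD.
exists (c * b)%g, (fun i => x (b (c i))); split=> // i j.
by rewrite permM; have := wE (b (c i)) j; rewrite xE rmorphM /=; lra.
Qed.

Lemma affine_left_mul (M' : 'M[R]_3) (e : bool) (c : 'S_3) (r : 'I_3 -> int) :
  ones *m M' = ones ->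
  (forall i j, M' i j = (-1) ^+ e * M (c i) j + (r i)%:~R) ->
  exists2 g, inG g & g *m M = M'.
Proof.
have [MU _ _] := ATM_M; move=> M'1 M'E.
have gM : affine_mx e c (\col_i (r i)%:~R) *m M = M'.
  by apply/matrixP => i j; rewrite affine_mxE ?ATM_ones // M'E mxE.
exists (affine_mx e c (\col_i (r i)%:~R)) => //; apply: affine_inG.
exists e, c, (\col_i (r i)%:~R); split=> //.
- by apply/mxOverP => i j; rewrite mxE rpred_int.
- by apply: (can_inj (mulmxK MU)); rewrite -mulmxA gM M'1 ATM_ones.
Qed.

End Conjugation.

(** * Reading off the three normal forms *)

Theorem theorem1 (R : realType) (M : 'M[R]_3) (hM : ATM M) :
  exists2 g : 'M[R]_3, inG g &
  [\/ (* Type I *)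
      exists c0 c1 : int,
        c0 + c1 + c1 = 1 /\
        g *m M = rows_mx 3 3 [:: [:: c0%:~R; c1%:~R; c1%:~R];
                                 [:: c1%:~R; c0%:~R; c1%:~R];
                                 [:: c1%:~R; c1%:~R; c0%:~R]],
      (* Type II *)
      exists c0 c1 : int,
        [/\ c0 + c1 + c1 = 3,
            (c0 = 1 %[mod 3])%Z
          & g *m M =
              invmx (Tmx (rows_mx 3 1 [:: [:: 1 / 3]; [:: 1 / 3]; [:: - (2 / 3)]]))
              *m rows_mx 3 3 [:: [:: c0%:~R / 3; c1%:~R / 3; c1%:~R / 3];
                                 [:: c1%:~R / 3; c0%:~R / 3; c1%:~R / 3];
                                 [:: c1%:~R / 3; c1%:~R / 3; c0%:~R / 3]]]
    | (* Type III *)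
      exists k : int,
        g *m M = rows_mx 3 3 [:: [:: 0; k%:~R; - k%:~R];
                                 [:: - k%:~R; 0; k%:~R];
                                 [:: k%:~R + 1; - k%:~R + 1; 1]]].
Proof.
have [c [m [mE mform]]] := ATM_integral_form hM.
case: mform => [[k [t tE]]|[k [t tE]]]; last first.
  have [||g Gg gM] := affine_left_mul hM (c := c) (e := false)
    (r := fun i => (i == 2)%:R - t i)
    (M' := rows_mx 3 3 [:: [:: 0; k%:~R; - k%:~R]; [:: - k%:~R; 0; k%:~R];
                           [:: k%:~R + 1; - k%:~R + 1; 1]]).
  - apply/matrixP => i j; rewrite !mxE big_ord3 !mxE.
    by move: j; apply: ord3_ind => /=; ring.
  - move=> i j; rewrite mE tE mxE.
    by move: i j; do 2![apply: ord3_ind] => /=; rewrite !(rmorphD, rmorphN, rmorphM) /=; ring.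
  by exists g => //; constructor 3; exists k.
(* Left multiplication can change the sign of [k] and replace [t]; Type I then needs the signed [k]
   to equal c0 - c1 = 1 - 3 c1. *)
have typeI (e : bool) (c1 : int) : (-1) ^+ e * k = 1 - 3 * c1 ->
    exists2 g, inG g & g *m M = rows_mx 3 3
      [:: [:: (1 - 2 * c1)%:~R; c1%:~R; c1%:~R]; [:: c1%:~R; (1 - 2 * c1)%:~R; c1%:~R];
          [:: c1%:~R; c1%:~R; (1 - 2 * c1)%:~R]].
  move=> kE; apply: (affine_left_mul hM (c := c) (e := e)
    (r := fun i => c1 - (-1) ^+ e * t i)).
    apply/matrixP => i j; rewrite !mxE big_ord3 !mxE.
    by move: j; apply: ord3_ind => /=; rewrite !(rmorphB, rmorphM) /=; ring.
  have kR : (-1) ^+ e * k%:~R = 1 - 3 * c1%:~R :> R.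
    by have := congr1 (intr : int -> R) kE; rewrite rmorphB !rmorphM rmorphXn rmorphN.
  move=> i j; rewrite mE tE mxE.
  move: i j; do 2![apply: ord3_ind] => /=;
    rewrite !(rmorphD, rmorphN, rmorphM, rmorphXn) /= ?mulrDr ?kR; ring.
(* One of k, -k is 1 mod 3 unless 3 divides k, and that last case gives Type II. *)
have [l [kl|kl|kl]] : exists l : int, [\/ k = 1 - 3 * l, k = 3 * l - 1 | k = 3 * l].
  have : [|| (k %% 3)%Z == 0, (k %% 3)%Z == 1 | (k %% 3)%Z == 2] by lia.
  case/or3P => /eqP k3; [exists (k %/ 3)%Z | exists (- (k %/ 3)%Z) | exists ((k %/ 3)%Z + 1)];
    [constructor 3 | constructor 1 | constructor 2]; lia.
- have [|g Gg gM] := typeI false l; first by rewrite expr0 mul1r.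
  exists g => //; constructor 1; exists (1 - 2 * l), l; split=> //; lia.
- have [|g Gg gM] := typeI true l; first by rewrite expr1 kl; ring.
  exists g => //; constructor 1; exists (1 - 2 * l), l; split=> //; lia.
set w : 'cV[R]_3 := rows_mx 3 1 [:: [:: 1 / 3]; [:: 1 / 3]; [:: - (2 / 3)]].
have TU : Tmx w \in unitmx.
  have [//] : Tmx w \in unitmx /\ Tmx (- w) \in unitmx.
  apply: mulmx1_unit; apply/matrixP => i j; rewrite !mxE big_ord3 !mxE !big_ord1 !mxE.
  by move: i j; do 2![apply: ord3_ind] => /=; field.
(* Adding [w] to every column of [M'] gives off-diagonal entries 1/3 - l and diagonal entries 1/3 +
   2l, hence c1 = 1 - 3l and c0 = 1 + 6l. *)
pose M' : 'M[R]_3 := \matrix_(i, j) ((if i == j then k else 0) + (i == 2)%:R - l)%:~R.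
have M'1 : (const_mx 1 : 'rV[R]_3) *m M' = const_mx 1.
  apply/matrixP => i j; rewrite !mxE big_ord3 !mxE kl.
  by move: j; apply: ord3_ind => /=; rewrite !(rmorphD, rmorphN, rmorphM) /=; ring.
have [|g Gg gM] := affine_left_mul hM (c := c) (e := false)
    (r := fun i => (i == 2)%:R - l - t i) M'1.
  by move=> i j; rewrite mE tE mxE expr0 mul1r -rmorphD; congr (_%:~R); ring.
exists g => //; constructor 2; exists (1 + 6 * l), (1 - 3 * l); split; [lia | lia |].
rewrite gM; apply: (can_inj (mulKmx TU)); rewrite mulKVmx //.
apply/matrixP => i j; rewrite !mxE big_ord3 !mxE !big_ord1 !mxE kl.
by move: i j; do 2![apply: ord3_ind] => /=;
  rewrite !(rmorphD, rmorphN, rmorphM) /=; field.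
Qed.
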